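(* There is a constant $c>0$ such that the inequality $$ m(n)>\frac{n^{\rho}}{\exp\left(c(\log n/\log\log n)^{1/\rho}\right)} $$ holds for infinitely many integers $n>0$.
   Context: For a positive integer $n$, $m(n)$ denotes the number of ordered factorizations of $n$ into factors larger than $1$, i.e. the number of finite sequences $(d_1,\dots,d_r)$, $r\ge 1$, of integers $d_i\ge 2$ with $d_1d_2\cdots d_r=n$. $\rho=1.72864\dots$ is the unique real number $\rho>1$ with $\zeta(\rho)=2$, where $\zeta(s)=\sum_{n\ge1}n^{-s}$. $\log$ is the natural logarithm. *)

(* Defs.v *)
From mathcomp Require Import all_boot all_order all_algebra.
From mathcomp Require Import finmap.
From mathcomp Require Import all_classical all_reals all_analysis.

Set Implicit Arguments.
Unset Strict Implicit.
Unset Printing Implicit Defensive.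

Import Order.TTheory GRing.Theory Num.Theory.

Local Open Scope classical_set_scope.

(* The empty sequence is excluded, so that 1 has no ordered factorization. *)
Definition ordered_factorizations (n : nat) : set (seq nat) :=
  [set s | [/\ s != [::], all (fun d => 1 < d)%N s & (\prod_(d <- s) d)%N = n]].

(* [fset_set] is the empty set on infinite sets; this case is ruled out by
   [finite_ordered_factorizations]. *)
Definition num_ordered_factorizations (n : nat) : nat :=
  #|` fset_set (ordered_factorizations n)|.

(* Extended-real valued: the sum is [+oo] exactly when the series diverges. *)
Definition zeta (R : realType) (s : R) : \bar R :=
  (\sum_(1 <= k <oo) (k%:R `^ (- s))%:E)%E.

Lemma finite_ordered_factorizations (n : nat) :
  finite_set (ordered_factorizations n).
Proof.
pose F n := [set s : seq nat |
  all (fun d => 1 < d)%N s /\ (\prod_(d <- s) d)%N = n].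
suff FF : finite_set (F n).
  by apply: sub_finite_set FF => s [_ ? ?].
elim/ltn_ind: n => n IH.
apply: (@sub_finite_set _ _ ([set [::]] `|`
  [set (d :: s)%SEQ | d in `I_n.+1 & s in \bigcup_(k in `I_n) F k])).
  move=> [|d s] [/=]; first by left.
  rewrite big_cons => /andP[d1 s1] dsn; right.
  have s0 : (0 < \prod_(e <- s) e)%N.
    rewrite big_seq; apply: prodn_cond_gt0 => e es.
    by apply: ltn_trans (allP s1 e es).
  exists d; first by rewrite /= ltnS -dsn leq_pmulr.
  exists s => //; exists (\prod_(e <- s) e)%N => //=.
  by rewrite -dsn ltn_Pmull.
rewrite finite_setU; split; first exact: finite_set1.
apply: finite_image2; first exact: finite_II.
by apply: bigcup_finite => [|k /=]; [exact: finite_II | exact: IH].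
Qed.

(* Main.v *)
Require Import Defs.
From mathcomp Require Import all_boot all_order all_algebra.
From mathcomp Require Import finmap zify ring lra.
From mathcomp Require Import all_classical all_reals all_analysis.

(** Draw [r] independent factors [d] with probability [d^-rho] (a probability
law on [d >= 2] since [zeta rho = 2]). A product [n] is hit with probability at
most [m(n) n^-rho], so it suffices that the law of the product is concentrated.
For a completely multiplicative weight [w] with [w(p) = q_p], Hoelder's
inequality gives
[[
  (E w(d))^r <= max_(n >= 2^r) m(n) n^-rho * prod_p 1 / (1 - q_p).
]]
Choosing [r] close to [N^rho] and [q_p = 1 - (p/N)^rho] for [p <= N], [q_p = 0]
otherwise, the logarithm of the loss is bounded by a sum over primes of a
decreasing function of [p/N] that is integrable on [(0, oo)]; by Chebyshev's
upper bound this sum is [O(N / ln N)], while [ln n >= r ln 2]. *)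

Import Order.TTheory GRing.Theory Num.Theory.

Local Open Scope classical_set_scope.
Local Open Scope ring_scope.

(** * Chebyshev's upper bound for the primes *)

Lemma prod_primes_dvdn (m n N : nat) :
  (forall p, prime p -> m <= p < n -> p %| N)%N ->
  (\prod_(m <= p < n | prime p) p %| N)%N.
Proof.
elim: n => [|n IH] dvdN; first by rewrite big_geq.
have [ltnm|lemn] := ltnP n m; first by rewrite big_geq.
have {}IH : (\prod_(m <= p < n | prime p) p %| N)%N.
  by apply: IH => p pp /andP[mp pn]; apply: dvdN => //; rewrite mp ltnS ltnW.
rewrite big_mkcond big_nat_recr //= -big_mkcond.
case: ifP => [pn|_]; last by rewrite muln1.
rewrite Gauss_dvd ?IH ?dvdN ?lemn//=.
rewrite big_nat_cond coprime_sym.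
elim/big_rec: _ => [|p x /andP[/andP[_ ltpn] pp] cx]; first by rewrite coprimen1.
rewrite coprimeMr cx andbT prime_coprime//.
by rewrite gtnNdvd// prime_gt0.
Qed.

Lemma prime_dvdn_fact (p m : nat) : prime p -> (p %| m`!)%N = (p <= m)%N.
Proof.
move=> pp; apply/idP/idP => [|pm]; last by rewrite dvdn_fact// prime_gt0.
elim: m => [|m IH]; first by rewrite fact0 Euclid_dvd1.
by rewrite factS Euclid_dvdM// => /orP[/dvdn_leq -> //|/IH/leqW].
Qed.

(** The two middle coefficients of row [2m+1] are equal, and the whole row sums to [2 * 4^m]. *)
Lemma bin_central_le (m : nat) : ('C(m.*2.+1, m) <= 4 ^ m)%N.
Proof.
have : (\sum_(i < m.*2.+2) 'C(m.*2.+1, i) = 2 * 4 ^ m)%N.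
  rewrite -[4%N]/(2 ^ 2)%N -expnM -expnS mul2n -[2%N in RHS]/(1 + 1)%N expnDn.
  by apply: eq_bigr => i _; rewrite !exp1n !muln1.
have mlt : (m < m.*2.+2)%N by lia.
have m1lt : (m.+1 < m.*2.+2)%N by lia.
rewrite (bigD1 (Ordinal mlt)) //= (bigD1 (Ordinal m1lt)) /=; last first.
  by rewrite -val_eqE /=; lia.
have -> : 'C(m.*2.+1, m.+1) = 'C(m.*2.+1, m).
  by rewrite -bin_sub; [congr 'C(_, _); lia | lia].
lia.
Qed.

(** Erdős's induction. An even number above 2 is not prime. For [2m+1], the primes in [[m+2, 2m+1]]
    divide [(2m+1)!] but neither [m!] nor [(m+1)!], so their product divides
    ['C(2m+1, m) <= 4^m]. *)
Lemma primorial_le (n : nat) : (\prod_(0 <= p < n.+1 | prime p) p <= 4 ^ n)%N.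
Proof.
elim/ltn_ind: n => -[|[|[|n]]] IH; try by rewrite unlock.
have := odd_double_half n; case: (odd n) => /= nE.
  have npr : ~~ prime n.+3.
    apply/negP => /even_prime[//|]; by rewrite -nE /= negbK odd_double.
  rewrite big_mkcond big_nat_recr //= (negbTE npr) muln1 -big_mkcond.
  by apply: leq_trans (IH n.+2 _) _ => //; rewrite leq_exp2l.
set m := (n./2.+1)%N; have {nE} -> : n.+3 = m.*2.+1 by lia.
rewrite (@big_cat_nat _ _ _ m.+2) //=; [|lia].
have -> : (4 ^ m.*2.+1 = 4 ^ m.+1 * 4 ^ m)%N by rewrite -expnD; congr expn; lia.
apply: leq_mul; first by apply: IH; lia.
apply: leq_trans (bin_central_le m).
apply: dvdn_leq; first by rewrite bin_gt0; lia.
apply: prod_primes_dvdn => p pp /andP[mp pm].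
have : (p %| 'C(m.*2.+1, m) * (m`! * (m.*2.+1 - m)`!))%N.
  rewrite bin_fact; last lia.
  by apply: dvdn_fact; rewrite prime_gt0//=; lia.
rewrite Euclid_dvdM // => /orP[//|].
by rewrite Euclid_dvdM // !prime_dvdn_fact //; lia.
Qed.

Lemma sum_ln_primes_le (R : realType) (n : nat) :
  \sum_(1 <= p < n.+1) (if prime p then ln (p%:R : R) else 0) <= ln 4 * n%:R.
Proof.
have gt0 m : (0 < \prod_(0 <= p < m | prime p) p)%N.
  by apply: prodn_cond_gt0 => p; apply: prime_gt0.
have -> : \sum_(1 <= p < n.+1) (if prime p then ln (p%:R : R) else 0) =
    ln ((\prod_(0 <= p < n.+1 | prime p) p)%N%:R : R).
  elim: n => [|n IH]; first by rewrite [LHS]big_geq// big_mkcond big_nat1 ln1.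
  rewrite big_nat_recr//= IH [in RHS]big_mkcond big_nat_recr//= -big_mkcond /=.
  case: ifP => pn; last by rewrite addr0 muln1.
  by rewrite natrM lnM// posrE ltr0n ?gt0// prime_gt0.
rewrite mulr_natr -lnXn; last by rewrite ltr0n.
by rewrite -natrX ler_ln ?posrE ?ltr0n ?gt0 ?expn_gt0// ler_nat primorial_le.
Qed.

(** * Partial summation and the total cost over primes *)

Lemma abel_sum_le (R : realType) (a f : nat -> R) (C : R) (n : nat) :
  (forall k, \sum_(1 <= m < k.+1) a m <= C * k%:R) ->
  (forall k, 0 <= f k) -> (forall k, (0 < k)%N -> f k.+1 <= f k) ->
  \sum_(1 <= m < n.+1) a m * f m <= C * \sum_(1 <= m < n.+1) f m.
Proof.
move=> aC f0 fD; rewrite -subr_ge0.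
(* The nonnegative boundary term of Abel summation; kept in the lower bound, it makes the induction
   go through. *)
apply: (@le_trans _ _ (f n * (C * n%:R - \sum_(1 <= m < n.+1) a m))).
  by rewrite mulr_ge0// subr_ge0.
elim: n => [|n IH]; first by rewrite !big_geq// !mulr0 !subr0 mulr0.
rewrite 3?(@big_nat_recr _ _ _ n.+1)//=.
have : f n.+1 * (C * n%:R - \sum_(1 <= m < n.+1) a m) <=
       f n * (C * n%:R - \sum_(1 <= m < n.+1) a m).
  case: n {IH} => [|n]; first by rewrite big_geq// !mulr0 subr0 !mulr0.
  by apply: ler_wpM2r; [rewrite subr_ge0 | exact: fD].
move=> /le_trans/(_ IH); rewrite -natr1; lra.
Qed.

Lemma ln_le_subr1 (R : realType) (x : R) : 0 < x -> ln x <= x - 1.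
Proof.
move=> x0; have -> : ln x = ln (1 + (x - 1)) by congr ln; lra.
by apply: le_ln1Dx; lra.
Qed.

(** A weak Stirling bound; the induction step amounts to [(n+1) ln((n+2)/(n+1)) <= 1]. *)
Lemma sum_ln_ge (R : realType) (n : nat) :
  n%:R * ln n%:R - n%:R <= \sum_(1 <= m < n.+1) ln (m%:R : R).
Proof.
elim: n => [|n IH]; first by rewrite big_geq// mul0r subr0.
rewrite big_nat_recr//=; case: n IH => [|n] IH; first by rewrite big_geq// ln1; lra.
suff : n.+1%:R * (ln n.+2%:R - ln (n.+1%:R : R)) <= 1.
  by move: IH; rewrite -[n.+2%:R]natr1; lra.
rewrite -ln_div ?posrE ?ltr0n//.
rewrite mulrC -ler_pdivlMr ?ltr0n//.
apply: le_trans (ln_le_subr1 _ _ _) _; first by rewrite divr_gt0 ?ltr0n.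
rewrite -[n.+2%:R]natr1 mulrDl divff ?pnatr_eq0//; by rewrite addrAC subrr add0r.
Qed.

(** Discrete form of the integral of [x^-rho] over [[n, n+k]]. The bound telescopes, each step
    resting on [e^x >= 1 + x] and [ln((j+1)/j) >= 1/(j+1)]. *)
Lemma sum_powRN_le (R : realType) (rho : R) (n k : nat) : 1 < rho -> (0 < n)%N ->
  (rho - 1) * \sum_(n.+1 <= m < n.+1 + k) m%:R `^ (- rho) <=
    n%:R `^ (1 - rho) - (n + k)%N%:R `^ (1 - rho).
Proof.
move=> rho1 n0; elim: k => [|k IH]; first by rewrite !addn0 big_geq// mulr0 subrr.
rewrite !addnS big_nat_recr/=; last by rewrite addSn ltnS leq_addr.
rewrite mulrDr; set j := (n + k)%N in IH *; have j0 : (0 < j)%N by rewrite addn_gt0 n0.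
rewrite addSn -/j.
suff : (rho - 1) * j.+1%:R `^ (- rho) <= j%:R `^ (1 - rho) - j.+1%:R `^ (1 - rho).
  by move: IH; lra.
have jne : j.+1%:R != 0 :> R by rewrite pnatr_eq0.
have jne' : j%:R != 0 :> R by rewrite pnatr_eq0 -lt0n.
have -> : j.+1%:R `^ (- rho) = j.+1%:R `^ (1 - rho) * j.+1%:R^-1 :> R.
  by rewrite -powR_inv1// -powRD ?jne ?implybT//; congr powR; lra.
have -> : j%:R `^ (1 - rho) = j.+1%:R `^ (1 - rho) *
    expR ((rho - 1) * (ln j.+1%:R - ln j%:R)) :> R.
  rewrite /powR (negbTE jne) (negbTE jne') -expRD; congr expR; lra.
have A0 : 0 < j.+1%:R `^ (1 - rho) :> R by rewrite powR_gt0 ?ltr0n.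
have E := expR_ge1Dx ((rho - 1) * (ln j.+1%:R - ln j%:R)).
have L : j.+1%:R^-1 <= ln j.+1%:R - ln j%:R :> R.
  have := @ln_le_subr1 R (j%:R / j.+1%:R).
  rewrite divr_gt0 ?ltr0n// ln_div ?posrE ?ltr0n// => /(_ isT).
  have -> : j%:R / j.+1%:R = 1 - j.+1%:R^-1 :> R.
    by rewrite -[j%:R](addrK 1) natr1 mulrBl divff// mul1r.
  by rewrite addrAC subrr add0r lerNr opprB.
have {}L : (rho - 1) * j.+1%:R^-1 <= (rho - 1) * (ln j.+1%:R - ln j%:R).
  by rewrite ler_wpM2l//; lra.
set e := expR _ in E *; set A := _ `^ _ in A0 *.
set i := _^-1 in L *.
have : A * ((rho - 1) * i) <= A * (e - 1) by rewrite ler_wpM2l; lra.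
lra.
Qed.

(* Dominates both logarithmic losses at the prime [m], namely
   [- ln (1 - q_m)] and [N^rho * m^-rho * (1 - q_m)]. *)
Definition cost (R : realType) (rho : R) (N m : nat) : R :=
  if (m <= N)%N then 1 + rho * ln (N%:R / m%:R) else (N%:R / m%:R) `^ rho.

Lemma cost_ge0 (R : realType) (rho : R) (N m : nat) : 0 <= rho ->
  0 <= cost R rho N m.
Proof.
move=> rho0; rewrite /cost; case: ifP => mN; last exact: powR_ge0.
rewrite addr_ge0// mulr_ge0//; case: m mN => [|m] mN; first by rewrite invr0 mulr0 ln0.
by rewrite ln_ge0// ler_pdivlMr ?ltr0n// mul1r ler_nat.
Qed.

Lemma cost_decr (R : realType) (rho : R) (N m : nat) : 0 <= rho -> (0 < m)%N ->
  cost R rho N m.+1 <= cost R rho N m.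
Proof.
move=> rho0 m0; rewrite /cost.
have le_div : N%:R / m.+1%:R <= N%:R / m%:R :> R.
  by rewrite ler_wpM2l// lef_pV2 ?posrE ?ltr0n// ler_nat.
case: ifP => [mN|]; first rewrite (ltnW mN).
  rewrite lerD2l ler_wpM2l// ler_ln// posrE divr_gt0// ltr0n//; lia.
move=> /negbT; rewrite -ltnNge ltnS => Nm; case: ifP => [mN|_]; last first.
  by rewrite ge0_ler_powR// nnegrE divr_ge0.
have {mN Nm} <- : m = N by lia.
rewrite divff ?pnatr_eq0 -?lt0n// ln1 mulr0 addr0.
rewrite -[leRHS](_ : 1 `^ rho = 1); last by rewrite powR1.
rewrite ge0_ler_powR ?nnegrE ?divr_ge0//.
by rewrite ler_pdivrMr ?ltr0n// mul1r ler_nat.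
Qed.

(** The terms up to [N] contribute at most [(1 + rho) N] by the Stirling bound, those beyond [N] at
    most [N / (rho - 1)] by the telescoped tail. *)
Lemma sum_cost_le (R : realType) (rho : R) (N n : nat) : 1 < rho -> (0 < N)%N ->
  \sum_(1 <= m < n.+1) cost R rho N m <= (1 + rho + (rho - 1)^-1) * N%:R.
Proof.
move=> rho1 N0; have rho0 : 0 <= rho by lra.
have N0' : 0 < N%:R :> R by rewrite ltr0n.
(* The longer range can be split at [N] whatever the size of [n]. *)
apply: (@le_trans _ _ (\sum_(1 <= m < N.+1 + n) cost R rho N m)).
  rewrite [leRHS](@big_cat_nat _ _ _ n.+1)//=; last lia.
  by rewrite lerDl sumr_ge0// => i _; exact: cost_ge0.
rewrite (@big_cat_nat _ _ _ N.+1) ?leq_addr//= mulrDl; apply: lerD.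
  rewrite (@eq_big_nat _ _ _ _ _ _ (fun m => 1 + rho * (ln N%:R - ln m%:R))); last first.
    move=> m /andP[m1 mN]; rewrite /cost -ltnS mN ln_div// posrE ltr0n//.
  rewrite big_split /= -mulr_sumr sumrB !sumr_const_nat subSS subn0.
  have := sum_ln_ge R N; rewrite [N%:R * _]mulrC mulr_natr => h.
  have : rho * (ln N%:R *+ N - \sum_(1 <= i < N.+1) ln i%:R) <= rho * N%:R.
    by rewrite ler_wpM2l//; lra.
  lra.
rewrite (@eq_big_nat _ _ _ _ _ _ (fun m => N%:R `^ rho * m%:R `^ (- rho))); last first.
  move=> m /andP[m1 mN]; rewrite /cost leqNgt m1 /= powRM ?invr_ge0//.
  by rewrite -powR_inv1// -powRrM mulN1r.
rewrite -mulr_sumr [leRHS]mulrC ler_pdivlMr; last lra.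
have := sum_powRN_le R rho N n rho1 N0 => h.
have {}h : N%:R `^ rho * ((rho - 1) * \sum_(N.+1 <= m < N.+1 + n) m%:R `^ (- rho)) <= N%:R `^ rho * N%:R `^ (1 - rho).
  rewrite ler_wpM2l ?powR_ge0//; apply: le_trans h _.
  by rewrite gerBl powR_ge0.
suff e : N%:R `^ rho * N%:R `^ (1 - rho) = N%:R :> R by move: h; rewrite e; lra.
rewrite -powRD ?pnatr_eq0 -?lt0n ?N0 ?implybT//.
have -> : rho + (1 - rho) = 1 by lra.
by rewrite powRr1.
Qed.

(** Each prime [p <= K] is charged the largest cost [f 1], in total at most [K (1 + 3 rho ln K)].
    For [p > K] one has [ln p / ln K >= 1], and Abel summation against Chebyshev's bound saves the
    factor [ln K]. The cutoff is a cube so that the threshold, its cube root, is an integer. *)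
Lemma sum_cost_primes_le (R : realType) (rho : R) (K n : nat) :
  1 < rho -> (1 < K)%N ->
  \sum_(1 <= p < n.+1 | prime p) cost R rho (K ^ 3) p <=
    (1 + 3 * rho + 4 * (1 + rho + (rho - 1)^-1)) * (K%:R ^+ 3 / ln K%:R).
Proof.
move=> rho1 K1; have rho0 : 0 <= rho by lra.
set N := (K ^ 3)%N; set C := 1 + rho + _; set f := cost R rho N.
have K1' : 1 < K%:R :> R by rewrite ltr1n.
set k : R := K%:R in K1' *; set l : R := ln k.
have l0 : 0 < l by apply: ln_gt0.
have lk : l <= k by apply/ltW/ln_sublinear; lra.
have f1 : f 1%N = 1 + 3 * rho * l.
  rewrite /f /cost expn_gt0 (ltnW K1)/= divr1 natrX lnXn -/k -/l; last lra.
  by rewrite -mulr_natr; lra.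
have fd m : (0 < m)%N -> f m <= f 1%N.
  elim: m => // -[//|m] IH _; apply: le_trans (IH isT).
  exact: cost_decr.
set a := fun p => if prime p then ln (p%:R : R) else 0.
have a0 p : 0 <= a p.
  by rewrite /a; case: ifP => // pp; rewrite ln_ge0// ler1n prime_gt0.
have C0 : 0 <= C.
  have : 0 < (rho - 1)^-1 by rewrite invr_gt0; lra.
  by rewrite /C; lra.
have A : \sum_(1 <= p < n.+1) a p * f p <= 4 * (C * k ^+ 3).
  apply: le_trans (abel_sum_le R a f (ln 4) n _ _ _) _.
  - by move=> j; apply: sum_ln_primes_le.
  - by move=> j; apply: cost_ge0.
  - by move=> j; apply: cost_decr.
  have ln4 : ln (4 : R) <= 4 by apply/ltW/ln_sublinear.
  apply: ler_pM => //; first by rewrite ln_ge0//; lra.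
    by rewrite sumr_ge0// => i _; exact: cost_ge0.
  by apply: le_trans (sum_cost_le R rho N n rho1 _) _; rewrite ?expn_gt0 ?(ltnW K1)// natrX.
have : \sum_(1 <= p < n.+1 | prime p) f p <=
    \sum_(1 <= p < n.+1) ((if (p <= K)%N then f 1%N else 0) + a p * f p / l).
  rewrite big_mkcond; apply: ler_sum_nat => p /andP[p0 _].
  have af : 0 <= a p * f p / l by rewrite !mulr_ge0 ?invr_ge0 ?(ltW l0)//; apply: cost_ge0.
  have f10 : 0 <= f 1%N by apply: cost_ge0.
  case: (leqP p K) => pK.
    by case: ifP => _; [have := fd p p0; lra | lra].
  rewrite add0r /a; case: ifP => pp; last by rewrite !mul0r.
  rewrite mulrAC ler_peMl//; first exact: cost_ge0.
  by rewrite ler_pdivlMr// mul1r /l ler_ln ?posrE ?ltr0n ?ler_nat; lia.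
move=> /le_trans; apply.
rewrite big_split /= -mulr_suml.
have -> : (1 + 3 * rho + 4 * C) * (k ^+ 3 / l) =
   (1 + 3 * rho) * (k ^+ 3 / l) + 4 * (C * k ^+ 3) / l by lra.
apply: lerD; last by rewrite ler_pM2r ?invr_gt0.
apply: (@le_trans _ _ (k * f 1%N)).
  have f10 : 0 <= f 1%N by apply: cost_ge0.
  apply: (@le_trans _ _ (\sum_(1 <= p < K.+1 + n) if (p <= K)%N then f 1%N else 0)).
    rewrite [leRHS](@big_cat_nat _ _ _ n.+1)//=; last lia.
    by rewrite lerDl sumr_ge0// => i _; case: ifP.
  rewrite (@big_cat_nat _ _ _ K.+1) ?leq_addr//=.
  rewrite [X in _ + X]big_nat_cond [X in _ + X]big1 ?addr0; last first.
    by move=> i /andP[/andP[Ki _] _]; rewrite leqNgt Ki.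
  rewrite (@eq_big_nat _ _ _ _ _ _ (fun=> f 1%N)); last by move=> i /andP[_]; rewrite ltnS => ->.
  by rewrite sumr_const_nat subSS subn0 mulr_natl.
rewrite f1 mulrA ler_pdivlMr//.
have kl : k * l <= k * k by rewrite ler_wpM2l//; lra.
have kll : k * l * l <= k * k * k.
  by apply: ler_pM => //; rewrite ?mulr_ge0//; lra.
have kk : k * k <= k * k * k by rewrite ler_peMr ?mulr_ge0//; lra.
have : rho * (k * l * l) <= rho * (k * k * k) by rewrite ler_wpM2l.
rewrite !exprS expr0 mulr1; lra.
Qed.

(** * Hoelder's upper bound for the weighted mean *)

(** Listing the values of [f] embeds these tuples into the ordered factorizations; [0 < r] keeps the
    list nonempty. *)
Lemma card_ffun_factorizations_le (B r n : nat) : (0 < r)%N ->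
  (#|[pred f : {ffun 'I_r -> 'I_B} |
      [forall i, 1 < f i] && (\prod_(i < r) f i == n)]|
    <= num_ordered_factorizations n)%N.
Proof.
move=> r0; rewrite /num_ordered_factorizations cardE.
set A := enum _; pose g (f : {ffun 'I_r -> 'I_B}) := [seq val (f i) | i <- enum 'I_r].
have g_inj : injective g.
  move=> f1 f2 /eq_in_map e; apply/ffunP => i; apply: val_inj.
  by apply: e; rewrite mem_enum.
rewrite -(size_map g); apply: uniq_leq_size.
  by rewrite map_inj_uniq// enum_uniq.
move=> s /mapP[f]; rewrite mem_enum inE => /andP[/forallP f1 /eqP fn] ->.
rewrite in_fset_set; last exact: finite_ordered_factorizations.
rewrite inE; split.
- by rewrite -size_eq0 size_map size_enum_ord -lt0n.
- by apply/allP => _ /mapP[i _ ->]; exact: f1.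
- by rewrite big_map big_enum.
Qed.

(** On positive [n], the completely multiplicative function with value [q p] at primes [p < B] and 1
    at larger primes; composite indices contribute 1, as [logn] vanishes there. *)
Definition weight (R : realType) (q : nat -> R) (B n : nat) : R :=
  \prod_(p < B) q p ^+ logn p n.

Lemma weightM (R : realType) (q : nat -> R) (B m n : nat) :
  (0 < m)%N -> (0 < n)%N ->
  weight R q B (m * n) = weight R q B m * weight R q B n.
Proof.
move=> m0 n0; rewrite /weight -big_split; apply: eq_bigr => p _.
by rewrite lognM// exprD.
Qed.

Lemma prod_powR_weight (R : realType) (q : nat -> R) (B : nat) (s : R)
    (I : Type) (l : seq I) (d : I -> nat) : (forall i, 0 < d i)%N ->
  \prod_(i <- l) ((d i)%:R `^ s * weight R q B (d i)) =
  (\prod_(i <- l) d i)%N%:R `^ s * weight R q B (\prod_(i <- l) d i)%N.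
Proof.
move=> d0; elim: l => [|i l IH].
  rewrite !big_nil powR1 mul1r /weight big1// => p _.
  by rewrite logn1 expr0.
rewrite !big_cons IH natrM powRM// weightM ?prodn_gt0//; lra.
Qed.

Lemma geometric_sum_le (R : realType) (x : R) (n : nat) : 0 <= x < 1 ->
  \sum_(i < n) x ^+ i <= (1 - x)^-1.
Proof.
move=> /andP[x0 x1]; rewrite -[leRHS]mul1r ler_pdivlMr; last lra.
have := subrX1 x n; have := exprn_ge0 n x0; lra.
Qed.

Lemma logn_prod_ord (B r p : nat) (f : {ffun 'I_r -> 'I_B}) :
  (B <= p)%N -> (forall i, 0 < f i)%N -> logn p (\prod_(i < r) f i) = 0%N.
Proof.
move=> Bp f0.
suff [] : (0 < \prod_(i < r) f i)%N /\ logn p (\prod_(i < r) f i) = 0%N by [].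
apply: (big_ind (fun x => 0 < x /\ logn p x = 0)%N).
- by rewrite logn1.
- by move=> x y [x0 ex] [y0 ey]; rewrite muln_gt0 x0 y0 lognM// ex ey.
- move=> i _; split=> //; rewrite lognE; case: ifP => // /and3P[_ _ pf].
  by have := dvdn_leq (f0 i) pf; rewrite leqNgt (leq_trans (ltn_ord _) Bp).
Qed.

(* Hoelder's inequality for the law of the product of [r] independent factors:
   tuples are grouped by their product, encoded by its exponent vector. *)
Lemma sum_weight_le (R : realType) (rho delta : R) (q : nat -> R) (B r : nat) :
  (0 < r)%N -> (forall p, 0 <= q p < 1) -> 0 <= delta ->
  (forall n, (2 ^ r <= n)%N ->
    (num_ordered_factorizations n)%:R * n%:R `^ (- rho) <= delta) ->
  (\sum_(d < B | (1 < d)%N) d%:R `^ (- rho) * weight R q B d) ^+ r <=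
    delta * \prod_(p < B) (1 - q p)^-1.
Proof.
move=> r0 q01 delta0 small.
pose N (f : {ffun 'I_r -> 'I_B}) := (\prod_(i < r) f i)%N.
pose P (f : {ffun 'I_r -> 'I_B}) := [forall i, 1 < f i]%N.
rewrite -[X in _ ^+ X](card_ord r) -prodr_const bigA_distr_big /=.
have eP f : (f \in ffun_on (fun d : 'I_B => 1 < d)%N) = P f.
  by apply/ffun_onP/forallP.
have Pgt0 f : P f -> forall i, (0 < f i)%N.
  by move=> /forallP Pf i; apply: ltnW; exact: Pf.
have N0 f : P f -> (0 < N f)%N by move=> Pf; apply: prodn_gt0 => i; exact: Pgt0.
have N2 f : P f -> (2 ^ r <= N f)%N.
  move=> /forallP Pf; rewrite -[X in (_ ^ X)%N](card_ord r) -prod_nat_const.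
  by apply: leq_prod => i _; exact: Pf.
have NB f : (N f <= B ^ r)%N.
  rewrite -[X in (_ ^ X)%N](card_ord r) -prod_nat_const.
  by apply: leq_prod => i _; exact: ltnW.
rewrite (eq_bigl P) //.
(* Each exponent is less than [N f <= B ^ r], so exponent vectors form a finite type, and the sum
   over all of them is a product of finite geometric sums. *)
set E := (B ^ r)%N in NB.
pose e f : {ffun 'I_B -> 'I_E.+1} := [ffun p : 'I_B => inord (logn p (N f))].
have eE f (p : 'I_B) : P f -> e f p = logn p (N f) :> nat.
  move=> Pf; rewrite ffunE inordK// ltnS (leq_trans _ (NB f))//.
  by apply/ltnW/ltn_logl/N0.
rewrite (partition_big e predT) //=.
apply: (@le_trans _ _ (\sum_(g : {ffun 'I_B -> 'I_E.+1})
    delta * \prod_(p < B) q p ^+ g p)); last first.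
  rewrite -mulr_sumr ler_wpM2l// -(bigA_distr_bigA (fun (p : 'I_B) (k : 'I_E.+1) => q p ^+ k)).
  apply: ler_prod => p _; rewrite geometric_sum_le ?q01// andbT.
  by apply: sumr_ge0 => k _; rewrite exprn_ge0//; have /andP[] := q01 p.
apply: ler_sum => g _.
apply: (@le_trans _ _ (\sum_(f | P f && (e f == g))
    (N f)%:R `^ (- rho) * \prod_(p < B) q p ^+ g p)).
  apply: ler_sum => f /andP[Pf /eqP <-].
  rewrite (prod_powR_weight R q B (- rho) _ _ (fun i => f i : nat)); last exact: Pgt0.
  rewrite le_eqVlt; apply/orP; left; apply/eqP; congr (_ * _).
  by rewrite /weight; apply: eq_bigr => p _; rewrite eE.
rewrite -mulr_suml ler_wpM2r//.
  by apply: prodr_ge0 => p _; rewrite exprn_ge0//; have /andP[] := q01 p.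
(* By unique factorization, all tuples in a nonempty fibre of [e] have the same product [N f0].
   Their number is thus at most [num_ordered_factorizations (N f0)], and [small] bounds the fibre by
   [delta]. *)
case: (pickP (fun f => P f && (e f == g))) => [f0 /andP[Pf0 /eqP ef0]|none]; last first.
  by rewrite big_pred0.
have Neq f : P f && (e f == g) -> N f = N f0.
  move=> /andP[Pf /eqP ef]; apply: eqn_from_log; [exact: N0|exact: N0|].
  move=> p; have [pB|Bp] := ltnP p B.
    by rewrite -(eE f (Ordinal pB))// -(eE f0 (Ordinal pB))// ef ef0.
  by rewrite !logn_prod_ord//; exact: Pgt0.
apply: le_trans (small (N f0) (N2 f0 Pf0)).
rewrite (eq_bigr (fun=> (N f0)%:R `^ (- rho))); last by move=> f /Neq ->.
rewrite sumr_const -[leLHS]mulr_natl ler_wpM2r ?powR_ge0// ler_nat.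
apply: leq_trans (card_ffun_factorizations_le B r (N f0) r0).
apply: subset_leq_card; apply/fintype.subsetP => f; rewrite !inE => Pf.
by apply/andP; split; [case/andP: Pf|apply/eqP/Neq].
Qed.

(** * Lower bound for the weighted mean *)

Lemma powRN_le_half (R : realType) (rho : R) (p : nat) : 1 <= rho -> (1 < p)%N ->
  p%:R `^ (- rho) <= 2^-1 :> R.
Proof.
move=> rho1 p1; apply: (@le_trans _ _ (p%:R `^ (- 1))).
  by apply: ler_powR; [rewrite ler1n ltnW | rewrite lerN2].
by rewrite powR_inv1// lef_pV2 ?posrE ?ltr0n ?ler_nat//; lia.
Qed.

(* With [T] the left-hand side, writing [d = p * j] gives
   [T <= p^-rho * (2 + T)]. *)
Lemma sum_logn_powR_le (R : realType) (rho : R) (B p : nat) :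
  1 < rho -> prime p -> \sum_(1 <= d < B) d%:R `^ (- rho) <= 2 :> R ->
  \sum_(1 <= d < B) (logn p d)%:R * d%:R `^ (- rho) <= 4 * p%:R `^ (- rho) :> R.
Proof.
move=> rho1 pp; set a : nat -> R := fun d => d%:R `^ (- rho).
rewrite -/(a p) => le2.
have a0 d : 0 <= a d by exact: powR_ge0.
set T := \sum_(1 <= d < B) _.
have T0 : 0 <= T by apply: sumr_ge0 => d _; rewrite mulr_ge0.
suff TT : T <= a p * (2 + T).
  have ap : a p <= 2^-1 by apply: powRN_le_half; [exact: ltW | exact: prime_gt1].
  have : a p * T <= 2^-1 * T by rewrite ler_wpM2r.
  lra.
pose h j := a p * a j * (1 + (logn p j)%:R).
have h0 j : 0 <= h j by rewrite !mulr_ge0// addr_ge0.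
apply: (@le_trans _ _ (\sum_(1 <= j < B) h j)); last first.
  rewrite /h (eq_bigr (fun j => a p * (a j + (logn p j)%:R * a j))); last first.
    by move=> j _; lra.
  by rewrite -mulr_sumr big_split /= ler_wpM2l// lerD2r.
apply: (@le_trans _ _ (\sum_(1 <= d < B) \sum_(1 <= j < B) if d == (p * j)%N then h j else 0)).
  apply: ler_sum_nat => d /andP[d0 dB].
  have [/dvdnP[j dE]|npd] := boolP (p %| d)%N; last first.
    rewrite lognE (negbTE npd) !andbF mul0r sumr_ge0// => j _.
    by case: ifP.
  have j0 : (0 < j)%N by move: d0; rewrite dE muln_gt0 => /andP[].
  have jB : (j < B)%N.
    by apply: leq_ltn_trans dB; rewrite dE leq_pmulr// prime_gt0.
  rewrite (bigD1_seq j) ?mem_index_iota ?j0 ?iota_uniq//= dE mulnC eqxx.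
  rewrite lognM ?(prime_gt0 pp)// logn_prime// eqxx natrD natrM powRM//.
  rewrite -/(a p) -/(a j) [leLHS]mulrC lerDl sumr_ge0// => i _.
  by case: ifP.
rewrite exchange_big_nat /=; apply: ler_sum_nat => j _.
rewrite -big_mkcond; have [pjB|Bpj] := boolP ((p * j)%N \in index_iota 1 B).
  rewrite -big_filter (_ : [seq _ <- _ | _] = [:: (p * j)%N]) ?big_seq1//.
  by rewrite filter_pred1_uniq ?iota_uniq.
rewrite big_seq_cond big_pred0// => d; apply/negP => /andP[dB /eqP dE].
by move: Bpj; rewrite -dE dB.
Qed.

(** A union bound: [1 - uv <= (1 - u) + (1 - v)] on [[0, 1]], applied once per factor with
    multiplicity. The range of the product is proved alongside because the induction uses it. *)
Lemma subr_prod_le (R : realType) (I : Type) (l : seq I) (x : I -> R) (k : I -> nat) :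
  (forall i, 0 <= x i <= 1) ->
  0 <= \prod_(i <- l) x i ^+ k i <= 1 /\
  1 - \prod_(i <- l) x i ^+ k i <= \sum_(i <- l) (k i)%:R * (1 - x i).
Proof.
move=> x01.
have H (u v : R) s t : 0 <= u <= 1 -> 0 <= v <= 1 -> 1 - u <= s -> 1 - v <= t ->
    0 <= u * v <= 1 /\ 1 - u * v <= s + t.
  move=> /andP[u0 u1] /andP[v0 v1] us vt.
  have uv0 : 0 <= u * v by rewrite mulr_ge0.
  have : 0 <= (1 - u) * (1 - v) by rewrite mulr_ge0//; lra.
  move=> uv; split; last by lra.
  by rewrite uv0 mulr_ile1.
elim: l => [|i l [IH1 IH2]]; first by rewrite !big_nil subrr lexx ler01 lexx.
rewrite !big_cons; apply: (H) => //.
  by have /andP[x0 x1] := x01 i; rewrite exprn_ge0// exprn_ile1.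
elim: (k i) => [|n IHn]; first by rewrite expr0 subrr mul0r.
have /andP[x0 x1] := x01 i.
rewrite exprS -add1n natrD mulrDl mul1r.
by apply: (H _ _ _ _ _ _ _ IHn).2 => //; rewrite ?x0// exprn_ge0// exprn_ile1.
Qed.

(** The union bound controls [1 - weight R q B d] by the sum over [p] of [logn p d * (1 - q p)].
    After exchanging the sums, [sum_logn_powR_le] gives [4 p^-rho] for each prime. *)
Lemma sum_weight_ge (R : realType) (rho : R) (q : nat -> R) (B : nat) :
  1 < rho -> (forall p, 0 <= q p <= 1) ->
  \sum_(1 <= d < B) d%:R `^ (- rho) <= 2 :> R ->
  \sum_(d < B | (1 < d)%N) d%:R `^ (- rho) -
    4 * \sum_(1 <= p < B | prime p) p%:R `^ (- rho) * (1 - q p) <=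
  \sum_(d < B | (1 < d)%N) d%:R `^ (- rho) * weight R q B d.
Proof.
move=> rho1 q01 le2; rewrite lerBlDr -lerBlDl -sumrB.
set a : nat -> R := fun d => d%:R `^ (- rho).
have a0 d : 0 <= a d by exact: powR_ge0.
have q1 p : 0 <= 1 - q p by have /andP[] := q01 p; rewrite subr_ge0.
apply: (@le_trans _ _ (\sum_(d < B | (1 < d)%N)
   \sum_(0 <= p < B) (1 - q p) * ((logn p d)%:R * a d))).
  apply: ler_sum => d _; rewrite -/(a d) big_mkord.
  rewrite (eq_bigr (fun p : 'I_B => a d * ((logn p d)%:R * (1 - q p)))); last first.
    by move=> p _; lra.
  rewrite -mulr_sumr -{1}[a d]mulr1 -mulrBr ler_wpM2l//.
  have [_] := subr_prod_le R 'I_B (index_enum 'I_B) (fun p => q p) (fun p => logn p d) (fun p => q01 p).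
  by [].
rewrite exchange_big /= mulr_sumr [leRHS]big_mkcond.
have -> : \sum_(1 <= p < B) (if prime p then 4 * (a p * (1 - q p)) else 0) =
    \sum_(0 <= p < B) (if prime p then 4 * (a p * (1 - q p)) else 0).
  by case: (B) => [|b]; [rewrite !big_geq | rewrite [RHS]big_ltn// add0r].
apply: ler_sum_nat => p _; case: ifP => [pp|npp]; last first.
  by rewrite big1// => d _; rewrite lognE npp mul0r mulr0.
rewrite -mulr_sumr mulrA [leRHS]mulrC ler_wpM2l//.
apply: le_trans (sum_logn_powR_le R rho B p rho1 pp le2).
rewrite big_geq_mkord big_mkcond [leRHS]big_mkcond /=; apply: ler_sum => d _.
by case: (d : nat) => [|[|n]]//=; rewrite mulr_ge0.
Qed.

(** * Truncated zeta sums and the choice of the weight *)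

Lemma zeta_partial_le (R : realType) (rho x : R) (B : nat) : zeta rho = x%:E ->
  \sum_(1 <= d < B) d%:R `^ (- rho) <= x.
Proof.
move=> zx; rewrite -lee_fin -zx -sumEFin /zeta.
by apply: nneseries_lim_ge => d _ _; rewrite lee_fin powR_ge0.
Qed.

Lemma zeta_partial_gt (R : realType) (rho x y : R) : zeta rho = x%:E -> y < x ->
  exists B, y < \sum_(1 <= d < B) d%:R `^ (- rho).
Proof.
move=> zx yx.
have : (y%:E < zeta rho)%E by rewrite zx lte_fin.
have nd := @ereal_nondecreasing_series R (fun d => (d%:R `^ (- rho))%:E) xpredT 1.
rewrite /zeta (cvg_lim _ (ereal_nondecreasing_cvgn (nd _)))//.
by move=> /ereal_sup_gt[_ [B _ <-]]; rewrite sumEFin lte_fin => yB; exists B.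
Qed.

(** In this range [(1 - t)(1 + 2t) >= 1], and [e^(2t) >= 1 + 2t]. This turns [(1 - t)^r] into an
    exponential lower bound. *)
Lemma expRN2_le (R : realType) (t : R) : 0 <= t <= 2^-1 -> expR (- (2 * t)) <= 1 - t.
Proof.
move=> /andP[t0 t1]; rewrite expRN -[leLHS]mul1r ler_pdivrMr ?expR_gt0//.
have := expR_ge1Dx (2 * t) => h.
apply: (@le_trans _ _ ((1 - t) * (1 + 2 * t))); last by rewrite ler_wpM2l//; lra.
have : 0 <= t * (2^-1 - t) by rewrite mulr_ge0//; lra.
lra.
Qed.

(** At a prime [p], the loss [- ln x + (N/p)^rho x] with [x = 1 - q_p] is least on [(0, 1]] at
    [x = (p/N)^rho] if [p <= N], and at [x = 1] otherwise; its minimum is [cost]. *)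
Definition decay (R : realType) (rho : R) (N p : nat) : R :=
  if prime p && (p <= N)%N then 1 - (p%:R / N%:R) `^ rho else 0.

Lemma powRVr (R : realType) (x s : R) : 0 <= x -> x^-1 `^ s = (x `^ s)^-1.
Proof. by move=> x0; rewrite -powR_inv1// -powRrM mulN1r powRN. Qed.

Lemma decay_bounds (R : realType) (rho : R) (N p : nat) : 0 <= rho ->
  0 <= decay R rho N p < 1.
Proof.
move=> rho0; rewrite /decay; case: ifP => [/andP[pp pN]|_]; last by rewrite lexx ltr01.
have p0 := prime_gt0 pp; have N0 : (0 < N)%N by lia.
have h : 0 < (p%:R / N%:R) `^ rho :> R by rewrite powR_gt0// divr_gt0 ?ltr0n.
have : (p%:R / N%:R) `^ rho <= 1 :> R.
  rewrite -[leRHS](_ : 1 `^ rho = 1); last by rewrite powR1.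
  rewrite ge0_ler_powR ?nnegrE ?divr_ge0//.
  by rewrite ler_pdivrMr ?ltr0n// mul1r ler_nat.
lra.
Qed.

Lemma inv_decay_le (R : realType) (rho : R) (N p : nat) : 0 <= rho ->
  (1 - decay R rho N p)^-1 <= expR (if prime p then cost R rho N p else 0).
Proof.
move=> rho0; rewrite /decay; have [pp|_] := boolP (prime p) => /=; last first.
  by rewrite subr0 invr1 expR0.
have p0 := prime_gt0 pp; rewrite /cost; case: ifP => pN; last first.
  by rewrite subr0 invr1 -expR0 ler_expR powR_ge0.
rewrite opprB addrCA subrr addr0 -powRVr ?divr_ge0// invf_div.
rewrite /powR ifF; last by apply/negbTE; rewrite mulf_neq0 ?invr_eq0 ?pnatr_eq0//; lia.
by rewrite ler_expR lerDr.
Qed.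

Lemma powRN_decay_le (R : realType) (rho : R) (N p : nat) : 0 <= rho ->
  (0 < N)%N -> prime p ->
  p%:R `^ (- rho) * (1 - decay R rho N p) <= N%:R `^ (- rho) * cost R rho N p.
Proof.
move=> rho0 N0 pp; rewrite /decay pp /= /cost; have p0 := prime_gt0 pp.
have px0 : (p%:R : R) `^ rho != 0 by rewrite gt_eqF// powR_gt0// ltr0n.
have Nx0 : (N%:R : R) `^ rho != 0 by rewrite gt_eqF// powR_gt0// ltr0n.
case: ifP => pN; last first.
  rewrite subr0 mulr1 powRM ?invr_ge0// powRVr// !powRN mulrA mulVf// mul1r//.
rewrite opprB addrCA subrr addr0 powRM ?invr_ge0// powRVr// !powRN mulrA mulVf//.
rewrite mul1r ler_peMr ?invr_ge0 ?powR_ge0// lerDl mulr_ge0// ln_ge0//.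
by rewrite ler_pdivlMr ?ltr0n// mul1r ler_nat.
Qed.

(** * Many factorizations at every large scale *)

(** By contradiction: if no [n >= 2^r] works, Hoelder's bound gives [Ew^r <= delta * e^F], which
    clashes with [Ew^r >= (1 - t)^r >= e^(-2rt)], where [rt = 1 + 4F]. *)
Lemma exists_many_factorizations (R : realType) (rho : R) :
  1 < rho -> zeta rho = 2%:E ->
  exists C : R, 0 < C /\ exists K0 : nat, forall K : nat, (K0 <= K)%N ->
  exists r n : nat, [/\ (K <= r)%N, (K ^ 3)%:R `^ rho <= 2 * r%:R :> R, (2 ^ r <= n)%N &
    expR (- (C * (K%:R ^+ 3 / ln K%:R))) <
      (num_ordered_factorizations n)%:R * n%:R `^ (- rho)].
Proof.
move=> rho1 zeta2; have rho0 : 0 <= rho by lra.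
set C2 := 1 + 3 * rho + 4 * (1 + rho + (rho - 1)^-1).
have C2gt0 : 0 < C2.
  have : 0 < (rho - 1)^-1 by rewrite invr_gt0; lra.
  rewrite /C2; lra.
(* The clash needs the exponent of [delta] to exceed [2 + 9F]: [2 + 8F] from [2rt] and [F] from the
   Euler product. Now [F <= C2 * Z], and [3Z > 2] because [Z >= 1]. *)
exists (9 * C2 + 3); split; first by lra.
(* Forces [ln K >= 16 * C2], hence [4F <= N/4], which together with [r >= 8] yields [t <= 1/2]. *)
exists (Num.truncn (expR (16 * C2))).+2 => K KK0.
have K2 : (2 <= K)%N by lia.
set k : R := K%:R.
have k2 : 2 <= k by rewrite /k ler_nat.
have lnK : 16 * C2 <= ln k.
  rewrite -[leLHS]expRK ler_ln ?posrE ?expR_gt0//; last lra.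
  apply: ltW; apply: lt_le_trans (truncnS_gt _) _.
  by rewrite /k ler_nat; exact: ltnW.
set N := (K ^ 3)%N; set Z := k ^+ 3 / ln k.
have lnk0 : 0 < ln k by lra.
have NE : N%:R = k ^+ 3 :> R by rewrite natrX.
have KN : (K <= N)%N by rewrite /N -[leqLHS]expn1 leq_exp2l.
have N8 : (8 <= N)%N by rewrite -[8%N]/(2 ^ 3)%N leq_exp2r.
have N0 : (0 < N)%N by lia.
have Z1 : 1 <= Z.
  rewrite ler_pdivlMr// mul1r; apply: (@le_trans _ _ k).
    by apply/ltW/ln_sublinear; lra.
  by rewrite -NE ler_nat.
have NNrho : N%:R <= N%:R `^ rho :> R by apply: le1r_powR; rewrite ?ler1n//; lra.
set r := Num.truncn (N%:R `^ rho : R).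
have Nr : (N <= r)%N by rewrite truncn_ge_nat// powR_ge0.
have r0 : (0 < r)%N by exact: leq_trans Nr.
have /andP[rle rlt] : r%:R <= (N%:R : R) `^ rho < r.+1%:R by rewrite truncn_itv// powR_ge0.
have r8 : 8 <= r%:R :> R by rewrite ler_nat (leq_trans N8).
have rge : (N%:R : R) `^ rho <= 2 * r%:R by move: rlt; rewrite -natr1; lra.
clearbody r.
exists r; apply/not_existsP => noN.
set delta := expR _ in noN.
have small n : (2 ^ r <= n)%N ->
    (num_ordered_factorizations n)%:R * n%:R `^ (- rho) <= delta.
  move=> rn; rewrite leNgt; apply/negP => dn; apply: (noN n).
  by split=> //; exact: leq_trans Nr.
have r0R : 0 < r%:R :> R by rewrite ltr0n.
(* Truncating zeta costs at most [1/r] in the mean, hence only a constant factor in its [r]-th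
   power. *)
have [B0 sB] : exists B, 2 - r%:R^-1 < \sum_(1 <= d < B) d%:R `^ (- rho).
  by apply: (zeta_partial_gt R rho 2) => //; rewrite ltrBlDr ltrDl invr_gt0.
have rV : r%:R^-1 <= 8^-1 :> R by rewrite lef_pV2 ?posrE//; lra.
(* A bound of at least 2 lets the term [d = 1] be split off. *)
have {sB}[b sB] : exists b, 2 - r%:R^-1 < \sum_(1 <= d < b.+2) d%:R `^ (- rho).
  case: B0 sB => [|[|b] sB]; last by exists b.
  - by rewrite big_geq//; set i := _^-1 in rV *; lra.
  - by move: sB; rewrite big_geq//; set i := _^-1 in rV *; lra.
set B := b.+2 in sB.
have le2 : \sum_(1 <= d < B) d%:R `^ (- rho) <= 2 by exact: zeta_partial_le.
pose q p := decay R rho N p.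
have q01 p : 0 <= q p < 1 by exact: decay_bounds.
have q01' p : 0 <= q p <= 1 by have /andP[-> /ltW] := q01 p.
have := sum_weight_ge R rho q B rho1 q01' le2.
have := sum_weight_le R rho delta q B r r0 q01 (ltW (expR_gt0 _)) small.
set Ew := \sum_(_ < B | _) _ * _; set W := \prod_(_ < B) _.
set L := \sum_(1 <= _ < B | _) _; set s := \sum_(_ < B | _) _ => EwW Ewge.
set F := \sum_(1 <= p < B | prime p) cost R rho N p.
have FZ : F <= C2 * Z by apply: sum_cost_primes_le.
have F0 : 0 <= F by apply: sumr_ge0 => p _; exact: cost_ge0.
have WF : W <= expR F.
  have -> : F = \sum_(p < B) (if prime p then cost R rho N p else 0).
    rewrite /F big_mkcond -(big_mkord xpredT (fun p => if prime p then cost R rho N p else 0)).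
    by rewrite [RHS]big_ltn//= add0r.
  rewrite expR_sum; apply: ler_prod => p _.
  rewrite inv_decay_le// andbT invr_ge0.
  by have /andP[_ /ltW] := q01 p; rewrite subr_ge0.
have LF : r%:R * L <= F.
  apply: (@le_trans _ _ (N%:R `^ rho * L)).
    rewrite ler_wpM2r// sumr_ge0// => p _; rewrite mulr_ge0 ?powR_ge0//.
    by have /andP[_ /ltW] := q01 p; rewrite subr_ge0.
  rewrite -ler_pdivlMl ?powR_gt0 ?ltr0n// -powRN /F mulr_sumr.
  by apply: ler_sum => p pp; exact: powRN_decay_le.
have sE : s = \sum_(1 <= d < B) d%:R `^ (- rho) - 1.
  rewrite big_ltn// powR1 addrAC subrr add0r big_geq_mkord /=.
  by apply: eq_bigl => d.
(* The total deficit of [Ew] from 1: [1/r] from truncating zeta and [4F/r] from the weight. *)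
set t := (1 + 4 * F) / r%:R.
have rt : r%:R * t = 1 + 4 * F by rewrite mulrC divfK ?gt_eqF.
clearbody F W L s Ew.
have t0 : 0 <= t by rewrite divr_ge0 ?(ltW r0R)//; lra.
have Z0 : 16 * C2 * Z <= k ^+ 3.
  have : Z * (16 * C2) <= Z * ln k by rewrite ler_wpM2l//; lra.
  by rewrite mulrC divfK// gt_eqF.
have t2 : t <= 2^-1.
  rewrite ler_pdivrMr//; have : N%:R <= r%:R :> R by rewrite ler_nat.
  rewrite NE; lra.
have Et : 1 - t <= Ew.
  apply: le_trans Ewge; rewrite sE.
  have : L <= F / r%:R by rewrite ler_pdivlMr// mulrC.
  have : t = r%:R^-1 + 4 * (F / r%:R) by rewrite /t mulrDl mul1r mulrA.
  set i := _^-1 in sB *; set FF := F / _; lra.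
have : expR (- (2 * (1 + 4 * F))) <= delta * expR F.
  apply: le_trans (le_trans EwW _); last by rewrite ler_wpM2l// ltW ?expR_gt0.
  rewrite -rt mulrCA -mulrN expRM_natl lerXn2r ?nnegrE ?expR_ge0//; last first.
    by apply: le_trans Et; rewrite expRN2_le// t0.
  apply: le_trans Et; lra.
rewrite -expRD ler_expR => h.
have : 9 * F <= 9 * (C2 * Z) by rewrite ler_wpM2l.
lra.
Qed.

(** * From the scale [K] to [ln n], and the conclusion *)

(** From [ln(y/x) <= y/x - 1] one gets [x (ln y - ln x) <= y - x <= (y - x) ln x], that is
    [x ln y <= y ln x]. *)
Lemma div_ln_le (R : realType) (x y : R) : 1 <= ln x -> 0 < x -> x <= y ->
  x / ln x <= y / ln y.
Proof.
move=> lx x0 xy; have y0 : 0 < y by lra.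
have ly : ln x <= ln y by rewrite ler_ln ?posrE.
rewrite ler_pdivrMr; last lra.
rewrite mulrAC ler_pdivlMr; last lra.
have := ln_le_subr1 R (y / x) (divr_gt0 y0 x0).
rewrite ln_div ?posrE// => h.
have : x * (ln y - ln x) <= x * (y / x - 1) by rewrite ler_wpM2l// ltW.
rewrite mulrBr mulrBr mulr1 mulrCA divff ?gt_eqF// mulr1.
have : 0 <= (y - x) * (ln x - 1) by rewrite mulr_ge0//; lra.
lra.
Qed.

Lemma half_le_ln2 (R : realType) : 2^-1 <= ln (2 : R).
Proof.
have := ln_le_subr1 R 2^-1; rewrite lnV ?posrE// invr_gt0 => /(_ (ltr0n _ 2)).
lra.
Qed.

(* [x / ln x] increases, and at [V = K^(3 rho)] it is
   [V / (3 rho ln K)]. *)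
Lemma div_ln_powR_le (R : realType) (rho : R) (K : nat) (X : R) :
  1 < rho -> 1 <= ln (K%:R : R) -> 1 < X -> (K ^ 3)%:R `^ rho <= 4 * X ->
  K%:R ^+ 3 / ln K%:R <= 12 * rho * (X / ln X) `^ rho^-1.
Proof.
move=> rho1 lK X1 VX.
have rV0 : 0 < rho^-1 by rewrite invr_gt0; lra.
have rV1 : rho^-1 <= 1 by rewrite invf_le1; lra.
have K0 : (0 < K)%N.
  by case: K lK {VX} => [|//]; rewrite ln0// ler10.
have lX0 : 0 < ln X by exact: ln_gt0.
set k : R := K%:R in lK *; set l := ln k in lK *.
have k0 : 0 < k by rewrite ltr0n.
have NE : (K ^ 3)%:R = k ^+ 3 :> R by rewrite natrX.
rewrite NE in VX; set V := _ `^ rho in VX.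
have V0 : 0 < V by rewrite powR_gt0// exprn_gt0.
have lV : ln V = rho * (3 * l).
  by rewrite ln_powR lnXn// -/l; lra.
have lr : l <= rho * l by have : 0 <= (rho - 1) * l; [rewrite mulr_ge0; lra | lra].
have lV3 : 3 <= ln V by rewrite lV; lra.
have step1 : V / ln V <= 4 * (X / ln X).
  have := div_ln_le R V (4 * X) _ V0 VX => /(_ ltac:(lra)) /le_trans; apply.
  rewrite mulrA ler_wpM2l//; first lra.
  rewrite lef_pV2 ?posrE// ?ler_ln ?posrE; try lra.
  by apply: ln_gt0; lra.
(* Here [V^(1/rho) = K^3], while [1 / ln V], lying in [(0, 1]], does not decrease under the power
   [1/rho <= 1]. *)
have step2 : k ^+ 3 / ln V <= (V / ln V) `^ rho^-1.
  rewrite powRM ?invr_ge0 ?(ltW V0)//; last lra.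
  rewrite /V -powRrM divff; last lra.
  rewrite powRr1 ?exprn_ge0 ?(ltW k0)// ler_wpM2l ?exprn_ge0 ?(ltW k0)//.
  apply: ger1_powR => //; rewrite invr_gt0 invf_le1 -/V; lra.
have step3 : (V / ln V) `^ rho^-1 <= 4 * (X / ln X) `^ rho^-1.
  have Y0 : 0 <= X / ln X by rewrite divr_ge0//; lra.
  have VV0 : 0 <= V / ln V by rewrite divr_ge0//; lra.
  set Y := X / ln X in step1 Y0 *.
  apply: (@le_trans _ _ ((4 * Y) `^ rho^-1)).
    by apply: ge0_ler_powR => //; [exact: ltW | rewrite nnegrE mulr_ge0].
  by rewrite powRM// ler_wpM2r ?powR_ge0// ler1_powR// ler1n.
have -> : k ^+ 3 / l = 3 * rho * (k ^+ 3 / ln V).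
  by rewrite lV; field; lra.
have : 3 * rho * (k ^+ 3 / ln V) <= 3 * rho * (4 * (X / ln X) `^ rho^-1).
  by rewrite ler_wpM2l; lra.
lra.
Qed.

Theorem theorem8 (R : realType) (rho : R) (rho_gt1 : 1 < rho)
    (zeta_rho : zeta rho = 2%:E) :
  exists c : R, 0 < c /\
    infinite_set [set n : nat | (0 < n)%N /\
      (num_ordered_factorizations n)%:R >
        n%:R `^ rho /
          expR (c * (ln n%:R / ln (ln n%:R)) `^ rho^-1)].
Proof.
have [C [C0 [K0 large]]] := exists_many_factorizations R rho rho_gt1 zeta_rho.
exists (12 * rho * C); split; first by rewrite !mulr_gt0//; lra.
move=> /finite_seqP[s sE].
(* If the set were the finite list [s], this [K] would exceed all its elements; but [n > r >= K]
   will satisfy the inequality. The middle summand ensures [ln K >= 1]. *)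
pose K := (K0 + (Num.truncn (expR 1 : R)).+3 + \max_(x <- s) x)%N.
have KT : ((Num.truncn (expR 1 : R)).+3 <= K)%N by rewrite /K; lia.
have [r [n [Kr Nr rn nlarge]]] := large K ltac:(lia).
have rn' : (r < n)%N by apply: leq_trans rn; exact: ltn_expl.
have n0 : (0 < n)%N by lia.
have n0R : 0 < n%:R :> R by rewrite ltr0n.
suff : n \in s.
  move=> ns; have : (n <= \max_(x <- s) x)%N by apply: leq_bigmax_seq.
  lia.
have : [set` s] n; last by [].
rewrite -sE; split=> //.
have lK : 1 <= ln (K%:R : R).
  have Kgt0 : (0 < K)%N by exact: leq_trans KT.
  rewrite -[leLHS]expRK ler_ln ?posrE ?expR_gt0 ?ltr0n//.
  by apply: ltW; apply: lt_le_trans (truncnS_gt _) _; rewrite ler_nat 2?ltnW.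
have lnn : r%:R * ln 2 <= ln (n%:R : R).
  rewrite mulr_natl -lnXn// ler_ln ?posrE ?exprn_gt0//.
  by rewrite -natrX ler_nat.
have lnn' : r%:R <= 2 * ln (n%:R : R).
  have : r%:R * 2^-1 <= r%:R * ln 2 :> R by rewrite ler_wpM2l// half_le_ln2.
  lra.
have r3 : 3 <= r%:R :> R by rewrite ler_nat; lia.
have X1 : 1 < ln (n%:R : R) by lra.
(* Since [ln 2 >= 1/2], [n >= 2^r] gives [2r <= 4 ln n]. *)
have VX : (K ^ 3)%:R `^ rho <= 4 * ln (n%:R : R) by lra.
have := div_ln_powR_le R rho K _ rho_gt1 lK X1 VX => h.
rewrite ltr_pdivrMr ?expR_gt0//.
have : C * (K%:R ^+ 3 / ln K%:R) <= 12 * rho * C * (ln n%:R / ln (ln n%:R)) `^ rho^-1.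
  have : C * (K%:R ^+ 3 / ln K%:R) <= C * (12 * rho * (ln n%:R / ln (ln n%:R)) `^ rho^-1).
    by rewrite ler_wpM2l// ltW.
  lra.
rewrite -ler_expR; move: nlarge; rewrite expRN powRN => nlarge le_exp.
move: nlarge; rewrite ltr_pdivlMr ?powR_gt0// mulrC ltr_pdivrMr ?expR_gt0//.
move=> /lt_le_trans; apply; rewrite ler_wpM2l//.
Qed.
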